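(* Let $\mathfrak T\subseteq\mathcal P(\Delta)$ be a structure with $\mathfrak L\subseteq\mathfrak T$, and let $M$ be a non-deterministic $\lambda$-term. If $\mathcal T(M)\in(\uparrow\mathfrak T)^\perp$, then $M$ is strongly normalizable. In particular this holds for $\mathfrak T\in\{\mathfrak L,\mathfrak B\}$.
   Context: Non-deterministic $\lambda$-terms are given by $M::=x\mid\lambda x.M\mid (M)N\mid M+N$, taken up to $\alpha$-equivalence and the identities $M+N=N+M$, $(M+N)+P=M+(N+P)$, $\lambda x.(M+N)=\lambda x.M+\lambda x.N$, $(M+N)P=(M)P+(N)P$. $\beta$-reduction is the contextual closure of $(\lambda x.M)N\to_\beta M[N/x]$. The term $M$ is strongly normalizable if it has no infinite $\beta$-reduction sequence. Resource terms ($\Delta$) are given by $s::=x\mid\lambda x.s\mid\langle s\rangle\bar t$, with bags $\bar t$ finite multisets of resource terms; $a^!$ is the set of bags with elements in $a$. The Taylor support $\mathcal T(M)$ is defined by: - $\mathcal T(x)=\{x\}$; - $\mathcal T(\lambda x.M)=\{\lambda x.s:s\in\mathcal T(M)\}$; - $\mathcal T((M)N)=\{\langle s\rangle\bar t:s\in\mathcal T(M),\bar t\in\mathcal T(N)^!\}$; - $\mathcal T(M+N)=\mathcal T(M)\cup\mathcal T(N)$. Resource reduction $\to_r$ acts on finite formal sums of resource terms with natural coefficients. It is generated by $\langle\lambda x.t\rangle[s_1,\dots,s_n]\to_r\sum_{f\in S_n}t[s_{f(1)}/x_1,\dots,s_{f(n)}/x_n]$ if $x_1,\dots,x_n$ are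 exactly the free occurrences of $x$ in $t$ (and $\to_r 0$ if the number of free occurrences differs from $n$). It is closed under the term constructors (including inside bags, extended linearly) and under linearity ($\alpha t+b\to_r\alpha a+b$ whenever $t\to_r a$, $\alpha\neq 0$). Write $t\ge s$ if $t\to_r^*a$ with $s$ in the support of $a$. Let $\uparrow a=\{t:\exists s\in a,\ t\ge s\}$ and, for a structure $\mathfrak T\subseteq\mathcal P(\Delta)$, $\uparrow\mathfrak T=\{\uparrow a:a\in\mathfrak T\}$. For a structure $\mathfrak S$, $\mathfrak S^\perp=\{a\subseteq\Delta:\forall a'\in\mathfrak S,\ a\cap a'\text{ finite}\}$. A resource term is linear if every bag occurring in it has cardinality $1$. $\mathfrak L$ is the set of all sets of linear resource terms. $\mathfrak B$ is the set of all $a\subseteq\Delta$ such that some $n$ bounds the cardinality of every bag in every term of $a$. *)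

(* Defs.v *)
From HB Require Import structures.
From mathcomp Require Import all_boot perm.
From mathcomp Require Import finmap multiset.
From mathcomp Require Import boolp classical_sets cardinality.
From Stdlib Require Import Relation_Operators.

Set Implicit Arguments.
Unset Strict Implicit.
Unset Printing Implicit Defensive.

Local Open Scope classical_set_scope.

(** * Non-deterministic lambda-terms *)

(* De Bruijn syntax, so alpha-equivalence is equality; the remaining identities
   are the relation [teq] below, and every notion on terms is taken modulo it. *)
Inductive term : Type :=
| Var of nat
| Lam of term
| App of term & term
| Add of term & term.

Inductive teq : term -> term -> Prop :=
| teq_refl M : teq M M
| teq_sym M N : teq M N -> teq N M
| teq_trans M N P : teq M N -> teq N P -> teq M P
| teq_Lam M M' : teq M M' -> teq (Lam M) (Lam M')
| teq_App M M' N N' : teq M M' -> teq N N' -> teq (App M N) (App M' N')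
| teq_Add M M' N N' : teq M M' -> teq N N' -> teq (Add M N) (Add M' N')
| teq_AddC M N : teq (Add M N) (Add N M)
| teq_AddA M N P : teq (Add (Add M N) P) (Add M (Add N P))
| teq_LamD M N : teq (Lam (Add M N)) (Add (Lam M) (Lam N))
| teq_AppD M N P : teq (App (Add M N) P) (Add (App M P) (App N P)).

(* [lift d k M] adds [d] to the variables of index at least [k]. *)
Fixpoint lift (d k : nat) (M : term) : term :=
  match M with
  | Var n => Var (if n < k then n else d + n)
  | Lam M => Lam (lift d k.+1 M)
  | App M N => App (lift d k M) (lift d k N)
  | Add M N => Add (lift d k M) (lift d k N)
  end.

(* [subst k N M] replaces variable [k] by [N] (whose free variables live
   outside the [k] innermost binders) and removes the binder of [k]. *)
Fixpoint subst (k : nat) (N M : term) : term :=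
  match M with
  | Var n => if n == k then lift k 0 N else Var (if k < n then n.-1 else n)
  | Lam M => Lam (subst k.+1 N M)
  | App M P => App (subst k N M) (subst k N P)
  | Add M P => Add (subst k N M) (subst k N P)
  end.

Inductive beta : term -> term -> Prop :=
| beta_redex M N : beta (App (Lam M) N) (subst 0 N M)
| beta_Lam M M' : beta M M' -> beta (Lam M) (Lam M')
| beta_AppL M M' N : beta M M' -> beta (App M N) (App M' N)
| beta_AppR M N N' : beta N N' -> beta (App M N) (App M N')
| beta_AddL M M' N : beta M M' -> beta (Add M N) (Add M' N)
| beta_AddR M N N' : beta N N' -> beta (Add M N) (Add M N').

(* One reduction step between the [teq]-classes of [M] and [N]. *)
Definition beta_mod (M N : term) : Prop :=
  exists M' N', [/\ teq M M', beta M' N' & teq N' N].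

Definition strongly_normalizable (M : term) : Prop :=
  ~ exists f : nat -> term, f 0 = M /\ forall n, beta_mod (f n) (f n.+1).

(** * Resource terms *)

(* Resource terms are the quotient of the following preterms by permutation of
   bags, at any depth. The quotient is realised by preterms in which every bag
   is sorted for a fixed total order; the order is arbitrary and is not used
   past [canon]. Lemmas [rapp_inj] and [rterm_ind] below show that [rterm] is
   freely generated by [rvar], [rlam] and [rapp]. *)
Inductive preterm : Type :=
| PVar of nat
| PLam of preterm
| PApp of preterm & seq preterm.

Lemma preterm_ind' (P : preterm -> Prop) :
  (forall n, P (PVar n)) -> (forall t, P t -> P (PLam t)) ->
  (forall t b, P t -> (forall i, i < size b -> P (nth (PVar 0) b i)) ->
     P (PApp t b)) ->
  forall t, P t.
Proof.
move=> hv hl ha; fix IH 1; case=> [n|t|t b].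
- exact: hv.
- exact/hl/IH.
- apply: ha; first exact: IH.
  elim: b => [|u b IHb] [|i] lt_i;
    [exact: (hv 0)|exact: (hv 0)|exact: (IH u)|exact: (IHb i lt_i)].
Qed.

Fixpoint preterm_encode (t : preterm) : GenTree.tree nat :=
  match t with
  | PVar n => GenTree.Leaf n
  | PLam t => GenTree.Node 0 [:: preterm_encode t]
  | PApp t b => GenTree.Node 1 (preterm_encode t :: map preterm_encode b)
  end.

Fixpoint preterm_decode (g : GenTree.tree nat) : preterm :=
  match g with
  | GenTree.Leaf n => PVar n
  | GenTree.Node 0 (g :: _) => PLam (preterm_decode g)
  | GenTree.Node _ (g :: gs) => PApp (preterm_decode g) (map preterm_decode gs)
  | GenTree.Node _ [::] => PVar 0
  end.

Lemma preterm_encodeK : cancel preterm_encode preterm_decode.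
Proof.
elim/preterm_ind' => [n|t IHt|t b IHt IHb] //=; first by rewrite IHt.
rewrite IHt -map_comp; congr PApp.
apply: (@eq_from_nth _ (PVar 0)); rewrite size_map // => i lt_i.
by rewrite (nth_map (PVar 0)) //= IHb.
Qed.

HB.instance Definition _ := Countable.copy preterm (can_type preterm_encodeK).

Definition preterm_le : rel preterm := relpre choice.pickle leq.

Fixpoint canon (t : preterm) : preterm :=
  match t with
  | PVar n => PVar n
  | PLam t => PLam (canon t)
  | PApp t b => PApp (canon t) (sort preterm_le (map canon b))
  end.

Lemma preterm_le_total : total preterm_le.
Proof. by move=> t u; exact: leq_total. Qed.

Lemma preterm_le_trans : transitive preterm_le.
Proof. by move=> t u v; exact: leq_trans. Qed.

Lemma preterm_le_anti : antisymmetric preterm_le.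
Proof. by move=> t u /anti_leq /(pcan_inj choice.pickleK). Qed.

Lemma canonK t : canon (canon t) = canon t.
Proof.
elim/preterm_ind': t => [n|t IHt|t b IHt IHb] //=; first by rewrite IHt.
rewrite IHt; congr PApp; rewrite [X in sort _ X]map_id_in.
  by rewrite sorted_sort ?sort_sorted //;
    [exact: preterm_le_trans|exact: preterm_le_total].
move=> u; rewrite mem_sort => /mapP[v /(nthP (PVar 0))[i lt_i <-] ->].
exact: IHb.
Qed.

Record rterm : Type := RTerm { rval :> preterm; _ : canon rval == rval }.
HB.instance Definition _ := [isSub for rval].
HB.instance Definition _ := [Countable of rterm by <:].

(* Finite multisets serve both as bags and as finite formal sums with
   coefficients in nat. *)
Notation bag := ({mset rterm})%mset.
Notation rsum := ({mset rterm})%mset.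

Definition rclass (t : preterm) : rterm := RTerm (introT eqP (canonK t)).

Definition rvar (n : nat) : rterm := rclass (PVar n).
Definition rlam (s : rterm) : rterm := rclass (PLam s).
Definition rapp (s : rterm) (b : bag) : rterm :=
  rclass (PApp s [seq rval u | u <- b]).

Lemma canon_rval (s : rterm) : canon s = s.
Proof. by case: s => t /= /eqP. Qed.

Lemma rclassK (s : rterm) : rclass s = s.
Proof. by apply: val_inj => /=; exact: canon_rval. Qed.

Lemma rclass_PLam t : rclass (PLam t) = rlam (rclass t).
Proof. by apply: val_inj; rewrite /= canonK. Qed.

Lemma rclass_PApp t (b : seq preterm) :
  rclass (PApp t b) = rapp (rclass t) (seq_mset [seq rclass u | u <- b]).
Proof.
apply: val_inj; rewrite /= canonK; congr PApp.
apply/(perm_sortP preterm_le_total preterm_le_trans preterm_le_anti).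
have -> : map canon b = map (canon \o rval) [seq rclass u | u <- b].
  by rewrite -map_comp; apply: eq_map => u /=; rewrite canonK.
rewrite -[X in perm_eq _ X]map_comp; apply: perm_map.
by rewrite perm_sym; exact: perm_eq_seq_mset.
Qed.

Lemma rlam_inj s s' : rlam s = rlam s' -> s = s'.
Proof. by move=> [] /=; rewrite !canon_rval => /val_inj. Qed.

Lemma rapp_inj s b s' b' : rapp s b = rapp s' b' -> s = s' /\ b = b'.
Proof.
move=> [] /=; rewrite !canon_rval => /val_inj -> eq_b; split=> //.
move/(perm_sortP preterm_le_total preterm_le_trans preterm_le_anti): eq_b.
rewrite -!map_comp.
rewrite !(eq_map (_ : canon \o rval =1 rval)); try exact: canon_rval.
move/(perm_map_inj val_inj)/eq_seq_msetP.
by rewrite !seq_mset_id.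
Qed.

Lemma rterm_ind (P : rterm -> Prop) :
  (forall n, P (rvar n)) -> (forall s, P s -> P (rlam s)) ->
  (forall s (b : bag), P s -> (forall t, t \in b -> P t) -> P (rapp s b)) ->
  forall s, P s.
Proof.
move=> hv hl ha s; rewrite -(rclassK s).
elim/preterm_ind': (rval s) => [n|t IHt|t b IHt IHb].
- exact: hv.
- by rewrite rclass_PLam; exact: hl.
- rewrite rclass_PApp; apply: ha => // u.
  rewrite (perm_mem (perm_eq_seq_mset _)) => /mapP[v].
  by move=> /(nthP (PVar 0))[i lt_i <-] ->; exact: IHb.
Qed.

(** * Resource reduction *)

Fixpoint plift (d k : nat) (t : preterm) : preterm :=
  match t with
  | PVar n => PVar (if n < k then n else d + n)
  | PLam t => PLam (plift d k.+1 t)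
  | PApp t b => PApp (plift d k t) (map (plift d k) b)
  end.

(* Number of free occurrences of the variable [k]. *)
Fixpoint occ (k : nat) (t : preterm) : nat :=
  match t with
  | PVar n => n == k
  | PLam t => occ k.+1 t
  | PApp t b => occ k t + sumn (map (occ k) b)
  end.

(* [fill k t us] replaces the free occurrences of variable [k] in [t], from left
   to right, by the successive elements of [us], and removes the binder of [k];
   it is meant for [size us = occ k t]. *)
Fixpoint fill (k : nat) (t : preterm) (us : seq preterm) : preterm :=
  match t with
  | PVar n => if n == k then plift k 0 (head (PVar 0) us)
              else PVar (if k < n then n.-1 else n)
  | PLam t => PLam (fill k.+1 t us)
  | PApp t b =>
      PApp (fill k t (take (occ k t) us))
        ((fix fill_bag (b us : seq preterm) : seq preterm :=
            match b with
            | [::] => [::]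
            | v :: b => fill k v (take (occ k v) us)
                        :: fill_bag b (drop (occ k v) us)
            end) b (drop (occ k t) us))
  end.

(* The reduct of <\x.t>[s_1, ..., s_n], with [x] the variable 0 of [t]. As the
   sum ranges over all permutations, with multiplicity, it depends neither on
   the enumeration of the bag nor on the representative chosen for [t]. *)
Definition redex_sum (t : rterm) (b : bag) : rsum :=
  if occ 0 t == size b then
    seq_mset [seq rclass (fill 0 t [seq rval (tnth (in_tuple b) (f i))
                                   | i : 'I_(size b)])
             | f : 'S_(size b)]
  else mset0.

Definition lin_ext (F : rterm -> rterm) (a : rsum) : rsum :=
  seq_mset [seq F s | s <- a].

Definition rscale (n : nat) (a : rsum) : rsum := iter n (msetD a) mset0.

Inductive rstep : rterm -> rsum -> Prop :=
| rstep_redex t b : rstep (rapp (rlam t) b) (redex_sum t b)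
| rstep_lam s a : rstep s a -> rstep (rlam s) (lin_ext rlam a)
| rstep_app s a b :
    rstep s a -> rstep (rapp s b) (lin_ext (fun s' => rapp s' b) a)
| rstep_bag s t a (b : bag) :
    rstep t a ->
    rstep (rapp s (t +` b)%mset) (lin_ext (fun t' => rapp s (t' +` b)%mset) a).

Inductive sum_step : rsum -> rsum -> Prop :=
| SumStep n t (a b : rsum) :
    0 < n -> rstep t a ->
    sum_step (rscale n [mset t]%mset `+` b)%mset (rscale n a `+` b)%mset.

Definition rge (t s : rterm) : Prop :=
  exists a : rsum, clos_refl_trans _ sum_step [mset t]%mset a /\ s \in a.

(** * Taylor support and structures *)

Definition bang (a : set rterm) : set bag :=
  [set b | forall t, t \in b -> a t].

Fixpoint Taylor (M : term) : set rterm :=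
  match M with
  | Var n => [set rvar n]
  | Lam M => [set rlam s | s in Taylor M]
  | App M N => [set u | exists s b, [/\ Taylor M s, bang (Taylor N) b & u = rapp s b]]
  | Add M N => Taylor M `|` Taylor N
  end.

Lemma Taylor_teq M N : teq M N -> Taylor M = Taylor N.
Proof.
elim=> //=.
- by move=> ? ? ? _ -> _ ->.
- by move=> ? ? _ ->.
- by move=> ? ? ? ? _ -> _ ->.
- by move=> ? ? ? ? _ -> _ ->.
- by move=> ? ?; rewrite setUC.
- by move=> ? ? ?; rewrite setUA.
- by move=> ? ?; rewrite image_setU.
- move=> M' N' P; apply/seteqP; split=> u.
  + by case=> s [b [[hs|hs] hb ->]]; [left|right]; exists s, b.
  + by case=> -[s [b [hs hb ->]]]; exists s, b; split=> //; [left|right].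
Qed.

Definition structure : Type := set (set rterm).

Definition up (a : set rterm) : set rterm :=
  [set t | exists s, a s /\ rge t s].

Definition up_struct (T : structure) : structure := [set up a | a in T].

Definition orth (S : structure) : structure :=
  [set a | forall a', S a' -> finite_set (a `&` a')].

(* [bag_in b t]: the bag [b] occurs in [t], at any depth. *)
Inductive bag_in (b : bag) : rterm -> Prop :=
| bag_in_here s : bag_in b (rapp s b)
| bag_in_lam s : bag_in b s -> bag_in b (rlam s)
| bag_in_app s (c : bag) : bag_in b s -> bag_in b (rapp s c)
| bag_in_bag s t (c : bag) : t \in c -> bag_in b t -> bag_in b (rapp s c).

Definition linear (t : rterm) : Prop := forall b : bag, bag_in b t -> size b = 1.

Definition linear_struct : structure := [set a | forall t, a t -> linear t].

Definition bounded_struct : structure :=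
  [set a | exists n : nat,
    forall t (b : bag), a t -> bag_in b t -> size b <= n].

(* Main.v *)
(* Let [a] be the set of all linear resource terms. It suffices that
   [Taylor M `&` up a] is finite, hence has elements of bounded size. This bound
   is preserved by beta, because every element of [Taylor M'] is reached by
   resource reduction from one of [Taylor M] and resource reduction decreases
   sizes. For a term without sums outside of arguments, firing a redex outside of
   arguments lowers the bound: such a redex is met by all the elements involved.
   Moreover the arguments have a smaller bound than the whole term, since a
   linear term can be built around any element of their Taylor support. By
   induction on the bound the arguments are strongly normalizable, so that only
   finitely many steps can occur in them between two steps that lower the bound. *)
From Stdlib Require Import SetoidList SetoidPermutation Relation_Operators.
Require Import Defs.
From mathcomp Require Import all_boot classical_sets.
From mathcomp Require Import zify perm finmap multiset cardinality.

Set Implicit Arguments.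
Unset Strict Implicit.
Unset Printing Implicit Defensive.

Local Open Scope classical_set_scope.

(** * Sums of simple terms *)

(** Normal form for the identities of [teq]: sums move out of abstractions and function positions
    but stay inside arguments, through which they do not distribute. *)
Fixpoint summands (M : term) : seq term :=
  match M with
  | Var n => [:: Var n]
  | Lam M => map Lam (summands M)
  | App M N => map (App^~ N) (summands M)
  | Add M N => summands M ++ summands N
  end.

Fixpoint simple (M : term) : bool :=
  match M with
  | Var _ => true
  | Lam M | App M _ => simple M
  | Add _ _ => false
  end.

Lemma summands_simple M : all simple (summands M).
Proof. by elim: M => //= [M|M IH N _|M IHM N IHN]; rewrite ?all_map // all_cat IHM. Qed.

Lemma simple_summands M : simple M -> summands M = [:: M].
Proof. by elim: M => //= [M IH|M IH N _] /IH ->. Qed.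

Lemma summands_neq0 M : summands M <> [::].
Proof. by elim: M => //= [M|M + N _|M + N _]; case: (summands M). Qed.

(** Putting a sum at a head variable creates new summands, hence the [flatten]. *)
Lemma summands_subst k N M :
  summands (subst k N M) = flatten [seq summands (subst k N s) | s <- summands M].
Proof.
elim: M k => [n|M IH|M IH P _|M IHM P IHP] k; first by rewrite /= cats0.
- by rewrite [LHS]/= IH map_flatten -!map_comp.
- by rewrite [LHS]/= IH map_flatten -!map_comp.
- by rewrite /= IHM IHP map_cat flatten_cat.
Qed.

#[local] Hint Resolve teq_refl teq_Lam teq_App teq_Add teq_AddC teq_AddA teq_LamD teq_AppD : core.

Lemma teq_lift M N d k : teq M N -> teq (Defs.lift d k M) (Defs.lift d k N).
Proof.
move=> eqMN; elim: eqMN k => /=; auto.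
- by move=> *; apply: teq_sym.
- by move=> ? ? ? _ IH1 _ IH2 k; exact: teq_trans (IH1 k) (IH2 k).
Qed.

Lemma teq_subst k M M' N N' :
  teq M M' -> teq N N' -> teq (subst k N M) (subst k N' M').
Proof.
move=> eqM eqN; have substr P j : teq (subst j N P) (subst j N' P).
  elim: P j => [n|P IH|P IH Q IHQ|P IH Q IHQ] j /=; auto.
  by case: eqP => _; [exact: teq_lift|].
apply: teq_trans (substr _ _) _; elim: eqM k => /=; auto.
- by move=> *; apply: teq_sym.
- by move=> ? ? ? _ IH1 _ IH2 k; exact: teq_trans (IH1 k) (IH2 k).
Qed.

(** What [teq] amounts to between simple terms: only arguments may vary. The [Add] case makes the
    relation an equivalence on all terms, as the library on [PermutationA] demands. *)
Fixpoint simple_teq (s t : term) : Prop :=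
  match s, t with
  | Var m, Var n => m = n
  | Lam s, Lam t => simple_teq s t
  | App s M, App t N => simple_teq s t /\ teq M N
  | Add s M, Add t N => teq s t /\ teq M N
  | _, _ => False
  end.

#[local] Instance simple_teq_equiv : Equivalence simple_teq.
Proof.
split.
- by elim=> //= *; split=> //; exact: teq_refl.
- elim=> [m|s IH|s IH M _|s _ M _] [n|t|t N|t N] //=; first exact: IH.
  + by move=> [/IH ? /teq_sym].
  + by move=> [/teq_sym ? /teq_sym].
- elim=> [m|s IH|s IH M _|s _ M _] [n|t|t N|t N] [p|u|u P|u P] //=.
  + by move=> -> ->.
  + exact: IH.
  + by move=> [h1 h2] [h3 h4]; split; [exact: IH h3|exact: teq_trans h4].
  + by move=> [h1 h2] [h3 h4]; split; [exact: teq_trans h3|exact: teq_trans h4].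
Qed.

Lemma simple_teq_teq s t : simple_teq s t -> teq s t.
Proof.
elim: s t => [m|s IH|s IH M _|s _ M _] [n|t|t N|t N] //=.
- by move=> ->; exact: teq_refl.
- by move=> /IH; constructor.
- by move=> [/IH ? ?]; constructor.
- by move=> [? ?]; constructor.
Qed.

Notation sperm := (PermutationA simple_teq).

Lemma sperm_refl l : sperm l l.
Proof. reflexivity. Qed.

Lemma sperm_sym l1 l2 : sperm l1 l2 -> sperm l2 l1.
Proof. by move=> eq_l; symmetry. Qed.

Lemma sperm_map f l1 l2 :
  (forall s t, simple_teq s t -> simple_teq (f s) (f t)) ->
  sperm l1 l2 -> sperm (map f l1) (map f l2).
Proof.
move=> fP; elim=> /=; try by move=> *; constructor; auto.
by move=> ? ? ? _ h1 _ h2; exact: permA_trans h1 h2.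
Qed.

Lemma sperm_cat l1 l1' l2 l2' :
  sperm l1 l1' -> sperm l2 l2' -> sperm (l1 ++ l2) (l1' ++ l2').
Proof. by move=> eq1 eq2; exact: PermutationA_app. Qed.

(** Distributivity becomes an equality of lists and commutativity an exchange of blocks, so a
    [teq]-class determines a multiset of simple terms up to [simple_teq]. *)
Lemma summands_teq M N : teq M N -> sperm (summands M) (summands N).
Proof.
elim=> {M N} /=.
- by move=> M; exact: sperm_refl.
- by move=> M N _; exact: sperm_sym.
- by move=> M N P _ h1 _ h2; exact: permA_trans h1 h2.
- by move=> M N _; apply: sperm_map.
- move=> M M' N N' _ h eqN _.
  apply: (permA_trans (sperm_map _ h)) => [s t|]; first by split=> //; exact: teq_refl.
  elim: (summands M') => [|s l IH]; constructor=> //; split=> //; reflexivity.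
- by move=> M M' N N' _ h1 _ h2; exact: sperm_cat.
- by move=> M N; exact: (PermutationA_app_comm simple_teq_equiv).
- by move=> M N P; rewrite catA; exact: sperm_refl.
- by move=> M N; rewrite map_cat; exact: sperm_refl.
- by move=> M N P; rewrite map_cat; exact: sperm_refl.
Qed.

(* The flag tells whether the fired redex lies outside of all arguments. *)
Inductive sstep : bool -> term -> term -> Prop :=
| sstep_redex s N : sstep true (App (Lam s) N) (subst 0 N s)
| sstep_Lam b s M : sstep b s M -> sstep b (Lam s) (Lam M)
| sstep_AppL b s M N : sstep b s M -> sstep b (App s N) (App M N)
| sstep_AppR s N N' : beta_mod N N' -> sstep false (App s N) (App s N').


Lemma sstep_simple s M : sstep false s M -> simple s -> simple M.
Proof. by move E: false => b sM; elim: sM E => //= {}s N <-. Qed.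

Lemma beta_mod_teql M M' N : teq M M' -> beta_mod M' N -> beta_mod M N.
Proof.
move=> eqM [P [Q [eqP bPQ eqQ]]]; exists P, Q; split=> //; exact: teq_trans eqP.
Qed.

(** A change of argument up to [teq] is absorbed by the [beta_mod] in [sstep_AppR], and by
    substitution when a redex fires. *)
Lemma sstep_teq b s t M :
  simple_teq s t -> sstep b s M -> exists2 N, sstep b t N & teq M N.
Proof.
move=> eq_st st; elim: st t eq_st => [u N|c u M' _ IH|c u M' N _ IH|u N N' bN] [n|t|t P|t P] //=.
- case: t => [?|t|? ?|? ?] [] //= eq_st eqN; exists (subst 0 P t); first by constructor.
  by apply: teq_subst => //; exact: simple_teq_teq.
- by move=> /IH[N ? ?]; exists (Lam N); auto; constructor.
- by move=> [/IH[M'' ? ?] ?]; exists (App M'' P); auto; constructor.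
- move=> [/simple_teq_teq eq_st eqN]; exists (App t N').
    by constructor; exact: beta_mod_teql (teq_sym eqN) bN.
  by constructor=> //; exact: teq_refl.
Qed.

(* Several summands may step at once: the argument [N] of [App (Add A B) N] is
   shared by two summands, as is the argument of a redex. *)
Inductive steps : bool -> seq term -> seq term -> Prop :=
| steps_nil : steps false [::] [::]
| steps_keep b s l L : steps b l L -> steps b (s :: l) (s :: L)
| steps_cons b c s M l L :
    sstep c s M -> steps b l L -> steps true (s :: l) (summands M ++ L).

Lemma steps_refl l : steps false l l.
Proof. by elim: l => [|s l IH]; constructor. Qed.

Lemma steps_false l L : steps false l L -> L = l.
Proof.
by move E: false => b st; elim: st E => [|c s K K' _ IH /IH ->|].
Qed.

Lemma steps_cat b c l l' L L' :
  steps b l L -> steps c l' L' -> steps (b || c) (l ++ l') (L ++ L').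
Proof.
move=> + st'; elim=> {b l L} [|b s l L _ IH|b d s M l L sM _ IH] //=.
  exact: steps_keep.
by rewrite -catA; apply: (steps_cons sM IH).
Qed.

Lemma steps_cat_inv b l l' L : steps b (l ++ l') L ->
  exists c d K K', [/\ L = K ++ K', steps c l K, steps d l' K' & b = c || d].
Proof.
elim: l b L => [|s l IH] b L /=.
  by move=> st; exists false, b, [::], L; split=> //; constructor.
move=> st; inversion st as [|b' s' l0 L0 st0|b' c s' M l0 L0 sM st0]; subst.
  have [c [d [K [K' [-> st1 st2 ->]]]]] := IH _ _ st0.
  by exists c, d, (s :: K), K'; split=> //; constructor.
have [c' [d [K [K' [-> st1 st2 _]]]]] := IH _ _ st0.
exists true, d, (summands M ++ K), K'; split; rewrite ?catA //.
exact: steps_cons sM st1.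
Qed.

Lemma steps_map (f : term -> term) b l L :
  (forall M, summands (f M) = map f (summands M)) ->
  (forall c s M, sstep c s M -> sstep c (f s) (f M)) ->
  steps b l L -> steps b (map f l) (map f L).
Proof.
move=> fS fst; elim=> {b l L} [|b s l L _ IH|b c s M l L sM _ IH] /=; try by constructor.
by rewrite map_cat -fS; apply: (steps_cons (fst _ _ _ sM) IH).
Qed.


Lemma steps_all b (f g : term -> term) l : l <> [::] ->
  (forall s, sstep b (f s) (g s)) ->
  steps true (map f l) (flatten [seq summands (g s) | s <- l]).
Proof.
move=> + fg; elim: l => // s [|s' l] IH _.
  by apply: steps_cons (fg s) _; constructor.
exact: steps_cons (fg s) (IH _).
Qed.

(** The step fires at once in all summands that share the redex. There is at least one by
    [summands_neq0], so the flag is [true]. *)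
Lemma beta_steps M N : beta M N -> steps true (summands M) (summands N).
Proof.
elim=> {M N} /=.
- move=> M N; rewrite -map_comp summands_subst.
  by apply: (@steps_all true) => [|s]; [exact: summands_neq0|constructor].
- by move=> M N _; apply: steps_map => // *; constructor.
- by move=> M M' N _; apply: (@steps_map (App^~ N)) => // *; constructor.
- move=> M N N' bN _.
  have -> : map (App^~ N') (summands M) =
            flatten [seq summands (App s N') | s <- summands M].
    elim: (summands M) (summands_simple M) => //= s l IH /andP[/simple_summands -> /IH ->].
    by [].
  apply: (@steps_all false) => [|s]; first exact: summands_neq0.
  by constructor; exists N, N'; split=> //; exact: teq_refl.
- by move=> M M' N _ st; exact: steps_cat st (steps_refl _).
- by move=> M N N' _ st; exact: steps_cat (steps_refl _) st.
Qed.

Lemma steps_sperm b l l' L : sperm l l' -> steps b l L ->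
  exists2 L', steps b l' L' & sperm L L'.
Proof.
move=> eq_l; elim: eq_l b L => {l l'} [|s t l l' eq_st eq_l IH|s t l|l l1 l2 _ IH1 _ IH2] b L st.
- by exists L => //; exact: sperm_refl.
- inversion st as [|b' s' l0 L0 st0|b' c s' M l0 L0 sM st0]; subst.
    by have [L' ? ?] := IH _ _ st0; exists (t :: L'); constructor.
  have [L' st' ?] := IH _ _ st0; have [N sN eqMN] := sstep_teq eq_st sM.
  exists (summands N ++ L'); first exact: steps_cons sN st'.
  by apply: sperm_cat => //; exact: summands_teq.
(* Swap: the reducts of the two heads form the blocks [K] and [K1], which are exchanged. *)
- have /(@steps_cat_inv _ [:: t] (s :: l))[c [d' [K [K' [-> st1 st2 ->]]]]] := st.
  have /(@steps_cat_inv _ [:: s] l)[d [e [K1 [K2 [-> st3 st4 ->]]]]] := st2.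
  exists (K1 ++ K ++ K2).
    rewrite orbCA; exact: (steps_cat st3 (steps_cat st1 st4)).
  rewrite !catA; apply: sperm_cat (sperm_refl _).
  exact: (PermutationA_app_comm simple_teq_equiv).
- have [L1 st1 eq1] := IH1 _ _ st; have [L2 st2 eq2] := IH2 _ _ st1.
  by exists L2 => //; exact: permA_trans eq1 eq2.
Qed.

Lemma beta_mod_steps M N : beta_mod M N ->
  exists2 L, steps true (summands M) L & sperm L (summands N).
Proof.
move=> [M' [N' [eqM /beta_steps st eqN]]].
have [L ? eqL] := steps_sperm (sperm_sym (summands_teq eqM)) st.
by exists L => //; exact: permA_trans (sperm_sym eqL) (summands_teq eqN).
Qed.

(** * Accessibility of terms and of lists of summands *)

Notation SN := (Acc (fun N M => beta_mod M N)).
Notation lSN := (Acc (fun L l => steps true l L)).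

Lemma lSN_SN M : lSN (summands M) -> SN M.
Proof.
(* The accessible list is only kept equal to the summands up to [sperm], because [beta_mod_steps]
   gives no more. *)
move=> lacc; move: (sperm_refl (summands M)); move: {1 3}(summands M) lacc => l lacc.
elim: lacc M => {}l _ IH M eq_l; constructor=> N /beta_mod_steps[L st eqL].
have [L' st' eqL'] := steps_sperm eq_l st.
exact: IH st' _ (permA_trans (sperm_sym eqL) eqL').
Qed.

(** Lexicographic induction: if the left part steps, the right part may become any accessible list;
    otherwise the flag forces the right part to step. *)
Lemma lSN_cat l l' : lSN l -> lSN l' -> lSN (l ++ l').
Proof.
move=> lacc; elim: lacc l' => {}l accl IH l' lacc'.
elim: lacc' => {}l' accl' IH'; constructor=> L.
move=> /steps_cat_inv[c [d [K [K' [-> st st' cd]]]]].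
have accK' : lSN K'.
  by case: d st' {cd} => st'; [exact: accl'|rewrite (steps_false st')].
case: c st cd => st cd; first exact: IH.
by rewrite (steps_false st); apply: IH'; rewrite [true]cd.
Qed.

Fixpoint args_SN (s : term) : Prop :=
  match s with
  | Var _ => True
  | Lam s => args_SN s
  | App s N => args_SN s /\ SN N
  | Add _ _ => False
  end.

(** Steps with flag [false] keep the spine of the term and act on a fixed finite family of
    arguments, each accessible: a product of well-founded relations. *)
Lemma args_SN_Acc s : args_SN s -> Acc (fun t s => sstep false s t) s.
Proof.
elim: s => [n|s IH|s IH N _|//] /=.
- by constructor=> t st; inversion st.
- move=> /IH; elim=> {IH}s _ IH; constructor=> t st.
  by inversion st; subst; exact: IH.
- move=> [/IH sacc Nacc]; elim: sacc N Nacc => {IH}s _ IHs N Nacc.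
  elim: (Nacc) => {Nacc}N Nacc IHN; constructor=> t st.
  inversion st; subst; last exact: IHN.
  by apply: IHs => //; constructor.
Qed.

Lemma SN_strongly_normalizable M : SN M -> strongly_normalizable M.
Proof.
elim=> {}M _ IH [f [f0 fS]]; apply: (IH (f 1)); first by rewrite -f0.
by exists (fun n => f n.+1).
Qed.

(** * Resource reduction and sizes *)

Lemma seq_mset_cat (l l' : seq rterm) :
  seq_mset (l ++ l') = (seq_mset l `+` seq_mset l')%mset.
Proof. by apply/msetP => x; rewrite msetE2 !mset_seqE count_cat. Qed.

Lemma mem_seq_mset (l : seq rterm) : seq_mset l =i l.
Proof. exact/perm_mem/perm_eq_seq_mset. Qed.

Lemma perm_mset1D (t : rterm) (b : bag) : perm_eq (t +` b)%mset (t :: b).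
Proof.
have <- : seq_mset (t :: b) = (t +` b)%mset by rewrite mset_cons seq_mset_id.
exact: perm_eq_seq_mset.
Qed.

Fixpoint psize (t : preterm) : nat :=
  match t with
  | PVar _ => 1
  | PLam t => (psize t).+1
  | PApp t b => (psize t + sumn (map psize b)).+1
  end.

Definition rsize (s : rterm) : nat := psize s.

Lemma psize_canon t : psize (canon t) = psize t.
Proof.
elim/preterm_ind': t => [n|t IH|t b IHt IHb] //=; first by rewrite IH.
rewrite IHt; congr (_ + _).+1.
rewrite (perm_sumn (perm_map _ (permEl (perm_sort _ _)))) -map_comp.
congr sumn; apply: (@eq_from_nth _ 0); rewrite !size_map // => i lt_i.
by rewrite !(nth_map (PVar 0)) //=; exact: IHb.
Qed.

Lemma psize_plift d k t : psize (plift d k t) = psize t.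
Proof.
elim/preterm_ind': t k => [n|t IH|t b IHt IHb] k //=; first by rewrite IH.
rewrite IHt -map_comp; congr (_ + sumn _).+1.
apply: (@eq_from_nth _ 0); rewrite !size_map // => i lt_i.
by rewrite !(nth_map (PVar 0)) //=; exact: IHb.
Qed.

Lemma rval_rapp s (b : bag) :
  rapp s b = PApp s (sort preterm_le (map rval b)) :> preterm.
Proof.
rewrite /= canon_rval -map_comp (eq_map (_ : canon \o rval =1 rval)) //.
exact: canon_rval.
Qed.

Lemma rsize_rapp s (b : bag) : rsize (rapp s b) = (rsize s + sumn (map rsize b)).+1.
Proof.
rewrite /rsize rval_rapp /=; congr (_ + _).+1.
by rewrite (perm_sumn (perm_map _ (permEl (perm_sort _ _)))) -map_comp.
Qed.

Lemma rsize_rlam s : rsize (rlam s) = (rsize s).+1.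
Proof. by rewrite /rsize /= canon_rval. Qed.

Lemma rsize_rapp1D s t (b : bag) :
  rsize (rapp s (t +` b)%mset) = (rsize s + (rsize t + sumn (map rsize b))).+1.
Proof. by rewrite rsize_rapp (perm_sumn (perm_map _ (perm_mset1D _ _))). Qed.

(** Names the anonymous inner fixpoint of [fill]. *)
Fixpoint fill_bag (k : nat) (b us : seq preterm) : seq preterm :=
  match b with
  | [::] => [::]
  | v :: b => fill k v (take (occ k v) us) :: fill_bag k b (drop (occ k v) us)
  end.

Lemma fill_PApp k t b us :
  fill k (PApp t b) us =
  PApp (fill k t (take (occ k t) us)) (fill_bag k b (drop (occ k t) us)).
Proof. by rewrite /=; congr PApp; elim: b (drop _ _) => //= v b IH vs; rewrite IH. Qed.

(** Each preterm consumes exactly its own block, so [take] and [drop] undo the [flatten]. *)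
Lemma fill_bag_flatten k (l : seq (preterm * seq preterm)) :
  (forall v, v \in l -> occ k v.1 = size v.2) ->
  fill_bag k (map fst l) (flatten (map snd l)) = [seq fill k v.1 v.2 | v <- l].
Proof.
elim: l => //= v l IH lP; rewrite (lP v (mem_head _ _)) take_size_cat // drop_size_cat //.
by rewrite IH // => w wl; apply: lP; rewrite inE wl orbT.
Qed.

(* Each filled occurrence, a leaf of size 1, is traded for a term. *)
Lemma psize_fill k t us : size us = occ k t ->
  psize (fill k t us) + size us = psize t + sumn (map psize us).
Proof.
elim/preterm_ind': t k us => [n|t IH|t b IHt IHb] k us; first last.
- rewrite fill_PApp => /= sz; rewrite -[in RHS](cat_take_drop (occ k t) us) map_cat sumn_cat.
  have szl : size (take (occ k t) us) = occ k t by rewrite size_takel // sz leq_addr.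
  have szr : size (drop (occ k t) us) = sumn (map (occ k) b).
    by rewrite size_drop sz addKn.
  have := IHt _ _ szl; rewrite szl sz.
  have : forall vs, size vs = sumn (map (occ k) b) ->
    sumn (map psize (fill_bag k b vs)) + sumn (map (occ k) b)
    = sumn (map psize b) + sumn (map psize vs).
    elim: b IHb {sz szr} => [|v b IH] IHb vs /=; first by move/size0nil->.
    move=> sz'; rewrite -[in RHS](cat_take_drop (occ k v) vs) map_cat sumn_cat.
    have szl' : size (take (occ k v) vs) = occ k v by rewrite size_takel // sz' leq_addr.
    have := IHb 0 isT k _ szl'; rewrite szl' /=.
    have : size (drop (occ k v) vs) = sumn (map (occ k) b) by rewrite size_drop sz' addKn.
    move=> /(IH (fun i => IHb i.+1)); lia.
  move=> /(_ _ szr); lia.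
- by move=> /= sz; have := IH k.+1 us sz; lia.
- rewrite /=; case: eqP => _; last by move/size0nil->.
  by case: us => [|u []] //= _; rewrite psize_plift; lia.
Qed.

Lemma mem_lin_ext F (a : rsum) s : s \in lin_ext F a -> exists2 t, t \in a & s = F t.
Proof. by rewrite mem_seq_mset => /mapP. Qed.

(** By [psize_fill] the contents of the bag only replace leaves, while the abstraction and the
    application of the redex disappear. The decrease is thus strict even for an empty bag. *)
Lemma rstep_rsize t a s : rstep t a -> s \in a -> rsize s < rsize t.
Proof.
move=> st; elim: st s => {t a} [t b|t a _ IH|t a b _ IH|t u a b _ IH] s.
- rewrite /redex_sum; case: eqP => [occ_b|_]; last by rewrite in_mset0.
  rewrite mem_seq_mset => /mapP[f _ ->].
  set us := [seq _ | i : _]; rewrite rsize_rapp rsize_rlam {1}/rsize psize_canon.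
  (* The total size of the bag does not depend on the permutation [f]. *)
  have us_b : perm_eq us (map rval b).
    have /(perm_map rval) : perm_eq [seq tnth (in_tuple b) (f i) | i : 'I_(size b)] b.
      by apply/(@tuple_permP _ (size b) _ (in_tuple b)); exists f.
    by rewrite -map_comp.
  have sz_us : size us = occ 0 t by rewrite (perm_size us_b) size_map occ_b.
  have := psize_fill sz_us; rewrite (perm_sumn (perm_map _ us_b)) -map_comp.
  rewrite -/(rsize t) (eq_map (_ : psize \o rval =1 rsize)) //; lia.
- by move=> /mem_lin_ext[u /IH ? ->]; rewrite !rsize_rlam.
- by move=> /mem_lin_ext[u /IH ? ->]; rewrite !rsize_rapp; lia.
- by move=> /mem_lin_ext[v /IH ? ->]; rewrite !rsize_rapp1D; lia.
Qed.

Lemma mem_rscale n (a : rsum) s : (s \in rscale n a) = (0 < n) && (s \in a).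
Proof.
elim: n => [|n IH]; first exact: in_mset0.
by rewrite /rscale /= in_msetD -/(rscale n a) IH; case: (s \in a); rewrite ?andbF.
Qed.

Lemma rge_rsize t s : rge t s -> rsize s <= rsize t.
Proof.
(* The induction along the reduction needs the bound for all elements of a sum, not only for a
   singleton. *)
move=> [a [st sa]]; have : forall u, u \in a -> rsize u <= rsize t.
  move: st; have : forall u, u \in [mset t]%mset -> rsize u <= rsize t.
    by move=> u; rewrite in_mset1 => /eqP->.
  move: [mset t]%mset => a0 + st; elim: st => {a0 a sa}
    // [_ _ [n u a b n0 ua] leb|a b c _ IH1 _ IH2 /IH1] //.
  move=> v; rewrite in_msetD mem_rscale => /orP[/andP[_ va]|vb].
    apply/ltnW/(leq_trans (rstep_rsize ua va))/leb.
    by rewrite in_msetD mem_rscale n0 in_mset1 eqxx.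
  by apply: leb; rewrite in_msetD vb orbT.
exact.
Qed.

(** * Reflexivity, transitivity and contextual closure of [rge] *)

Lemma rge_refl t : rge t t.
Proof. by exists [mset t]%mset; split; [exact: rt_refl|rewrite in_mset1]. Qed.

Lemma rge_rstep t a s : rstep t a -> s \in a -> rge t s.
Proof.
move=> ta sa; exists a; split=> //; apply: rt_step.
by have := @SumStep 1 t a mset0 isT ta; rewrite /rscale /= !msetD0.
Qed.

Lemma rge_trans t s u : rge t s -> rge s u -> rge t u.
Proof.
(* One copy of [s] is isolated in [a]; the rest of the sum is carried along while [s] reduces. *)
move=> [a [ta sa]] [b [sb ub]]; rewrite -(msetB1K sa) in ta.
exists (b `+` (a `\ s))%mset; split; last by rewrite in_msetD ub.
apply: rt_trans ta _; move: (a `\ s)%mset => e {a sa t}.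
elim: sb => {b u ub} [_ _ [n t b c n0 tb]|b|b c d _ IH1 _ IH2].
- by apply: rt_step; rewrite -!msetDA; constructor.
- exact: rt_refl.
- exact: rt_trans IH1 IH2.
Qed.

Lemma lin_ext_msetD F (a b : rsum) :
  lin_ext F (a `+` b)%mset = (lin_ext F a `+` lin_ext F b)%mset.
Proof.
rewrite /lin_ext -seq_mset_cat -map_cat; apply/eq_seq_msetP/perm_map.
have <- : seq_mset (a ++ b) = (a `+` b)%mset by rewrite seq_mset_cat !seq_mset_id.
exact: perm_eq_seq_mset.
Qed.

Lemma lin_ext1 F t : lin_ext F [mset t]%mset = [mset F t]%mset.
Proof.
apply/msetP => x; rewrite mset_seqE enum_msetn msetnE /= addn0 eq_sym.
by case: (x == F t).
Qed.

Lemma lin_ext_rscale F n a : lin_ext F (rscale n a) = rscale n (lin_ext F a).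
Proof.
elim: n => [|n IH]; last by rewrite /rscale /= lin_ext_msetD -/(rscale n a) IH.
by rewrite /lin_ext /rscale /= enum_mset0; apply/msetP => x; rewrite mset_seqE mset0E.
Qed.

(** A context compatible with single steps acts on whole reductions of sums through its linear
    extension. *)
Lemma rge_congr F t s :
  (forall u a, rstep u a -> rstep (F u) (lin_ext F a)) -> rge t s -> rge (F t) (F s).
Proof.
move=> FP [a [ta sa]]; exists (lin_ext F a); split; last first.
  by rewrite mem_seq_mset; apply: map_f.
rewrite -lin_ext1; elim: ta => {t a s sa} [_ _ [n u a b n0 ua]|a|a b c _ IH1 _ IH2].
- apply: rt_step; rewrite !lin_ext_msetD !lin_ext_rscale lin_ext1.
  by constructor=> //; exact: FP.
- exact: rt_refl.
- exact: rt_trans IH1 IH2.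
Qed.

Lemma rge_rlam t s : rge t s -> rge (rlam t) (rlam s).
Proof. by apply: rge_congr => *; constructor. Qed.

Lemma rge_rapp t s b : rge t s -> rge (rapp t b) (rapp s b).
Proof. by apply: (@rge_congr (rapp^~ b)) => *; constructor. Qed.

Lemma rge_bag u t s b : rge t s -> rge (rapp u (t +` b)%mset) (rapp u (s +` b)%mset).
Proof. by apply: (@rge_congr (fun t => rapp u (t +` b)%mset)) => *; constructor. Qed.

(** * Pulling beta back along the Taylor support *)

(** Finite choice, used to pick preimages for all the elements of a bag. *)
Lemma map_preimage (A B : eqType) (f : A -> B) (P : A -> Prop) (l : seq B) :
  (forall y, y \in l -> exists2 x, P x & y = f x) ->
  exists2 s, l = map f s & forall x, x \in s -> P x.
Proof.
elim: l => [|y l IH] lP; first by exists [::].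
have [x Px ->] := lP y (mem_head _ _).
have [z zl|s -> sP] := IH; first by apply: lP; rewrite inE zl orbT.
by exists (x :: s) => // z; rewrite inE => /predU1P[->|/sP].
Qed.

Lemma bangP (a : set rterm) l : bang a (seq_mset l) <-> forall t, t \in l -> a t.
Proof. by split=> + t => /(_ t); rewrite mem_seq_mset. Qed.

Lemma rapp_map_sort s (g : preterm -> rterm) (h : rterm -> rterm) (b : bag) :
  (forall t : rterm, g t = h t) ->
  rapp s (seq_mset [seq g u | u <- sort preterm_le (map rval b)]) =
  rapp s (seq_mset (map h b)).
Proof.
move=> gh; congr rapp; apply/eq_seq_msetP.
apply: (perm_trans (perm_map _ (permEl (perm_sort _ _)))).
by rewrite -map_comp (eq_map (_ : g \o rval =1 h)).
Qed.

Lemma Taylor_lift d k M u : Taylor (Defs.lift d k M) u ->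
  exists2 v, Taylor M v & u = rclass (plift d k v).
Proof.
elim: M k u => [n|M IH|M IHM N IHN|M IHM N IHN] k u /=.
- by move=> ->; exists (rvar n).
- move=> [s /IH[v Mv ->] <-]; exists (rlam v); first by exists v.
  by rewrite /= canon_rval rclass_PLam.
- move=> [s [b [/IHM[v Mv ->] bN ->]]].
  have [x /bN/IHN|l eq_b lN] :=
    @map_preimage _ _ (fun t : rterm => rclass (plift d k t)) (Taylor N) b.
    by move=> [w ? ?]; exists w.
  exists (rapp v (seq_mset l)); first by exists v, (seq_mset l); split=> //; exact/bangP.
  rewrite rval_rapp /= rclass_PApp -map_comp.
  rewrite (@rapp_map_sort _ _ (fun t : rterm => rclass (plift d k t))) //.
  rewrite -[b in LHS]seq_mset_id eq_b; congr rapp; apply/eq_seq_msetP/perm_map.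
  by rewrite perm_sym; exact: perm_eq_seq_mset.
- by move=> [/IHM|/IHN] [v ? ->]; exists v => //; [left|right].
Qed.

(** Every occurrence of [k] in [p] receives its own element of [Taylor N], chosen independently;
    [us] lists these choices in the order in which [fill] consumes them. *)
Lemma Taylor_subst k M N u : Taylor (subst k N M) u ->
  exists p (us : seq rterm), [/\ Taylor M p, forall v, v \in us -> Taylor N v,
    occ k p = size us & u = rclass (fill k p (map rval us))].
Proof.
elim: M k u => [n|M IH|M IHM P IHP|M IHM P IHP] k u /=.
- case: eqP => [->|/eqP neq_nk].
    move=> /Taylor_lift[v Nv ->]; exists (rvar k), [:: v].
    by split=> [|w||] //=; [rewrite inE => /eqP->|rewrite eqxx|rewrite eqxx].
  by move=> /= ->; exists (rvar n), [::]; rewrite /= (negbTE neq_nk).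
- move=> [s /IH[p [us [Mp usN sz ->]]] <-]; exists (rlam p), us.
  by split=> //=; [exists p|rewrite canon_rval|rewrite canon_rval rclass_PLam].
- move=> [s [b [/IHM[p0 [us0 [Mp0 us0N sz0 ->]]] bP ->]]].
  pose f (v : rterm * seq rterm) := rclass (fill k v.1 (map rval v.2)).
  have [x /bP/IHP|l eq_b lP] := @map_preimage _ _ f (fun v => [/\ Taylor P v.1,
      forall w, w \in v.2 -> Taylor N w & occ k v.1 = size v.2]) b.
    by move=> [p [us [? ? ? ?]]]; exists (p, us).
  (* Sorting the pairs by first component makes the left-to-right order of the
     substituted terms agree with the sorted representative of the bag. *)
  pose l' := sort (relpre (rval \o fst) preterm_le) l.
  have l'l : l' =i l by move=> v; rewrite mem_sort.
  have rvalE : rval (rapp p0 (seq_mset (map fst l'))) = PApp p0 (map (rval \o fst) l').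
    rewrite rval_rapp; congr PApp; rewrite map_comp -[RHS](sorted_sort preterm_le_trans).
      apply/(perm_sortP preterm_le_total preterm_le_trans preterm_le_anti)/perm_map.
      exact: perm_eq_seq_mset.
    by rewrite -map_comp sorted_map; apply: sort_sorted => ? ?; exact: preterm_le_total.
  exists (rapp p0 (seq_mset (map fst l'))), (us0 ++ flatten (map snd l')); split.
  + exists p0, (seq_mset (map fst l')); split=> //; apply/bangP => t /mapP[v + ->].
    by rewrite l'l => /lP[].
  + move=> v; rewrite mem_cat => /orP[/us0N //|/flatten_mapP[w]].
    by rewrite l'l => /lP[_ + _]; apply.
  + rewrite rvalE /= size_cat size_flatten /shape sz0 -!map_comp; congr (_ + sumn _).
    by apply/eq_in_map => v; rewrite l'l => /lP[].
  + pose l2 := [seq (rval v.1, map rval v.2) | v <- l'].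
    rewrite rvalE fill_PApp map_cat sz0 take_size_cat ?size_map // drop_size_cat ?size_map //.
    rewrite map_flatten -map_comp.
    have -> : map (rval \o fst) l' = map fst l2 by rewrite -map_comp.
    have -> : map (map rval \o snd) l' = map snd l2 by rewrite -map_comp.
    rewrite fill_bag_flatten => [|_ /mapP[v + ->]]; last first.
      by rewrite l'l size_map => /lP[].
    rewrite rclass_PApp -!map_comp -[b]seq_mset_id eq_b; congr rapp.
    by apply/eq_seq_msetP/perm_map; rewrite perm_sym; exact/permEl/perm_sort.
- by move=> [/IHM|/IHP] [p [us [? ? ? ?]]]; exists p, us; split=> //; [left|right].
Qed.

Lemma Taylor_redex M N u : Taylor (subst 0 N M) u ->
  exists t a, [/\ Taylor (App (Lam M) N) t, rstep t a & u \in a].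
Proof.
move=> /Taylor_subst[p [us [Mp usN sz ->]]]; pose b := seq_mset us.
exists (rapp (rlam p) b), (redex_sum p b); split; last 1 first.
- have us_b : perm_eq us b by rewrite perm_sym; exact: perm_eq_seq_mset.
  rewrite /redex_sum sz (perm_size us_b) eqxx mem_seq_mset.
  (* The permutation that turns the enumeration of [b] into [us] selects the summand equal to
     [u]. *)
  have /(@tuple_permP _ (size b) _ (in_tuple b))[f ->] := us_b.
  by apply/mapP; exists f; rewrite ?mem_enum // -map_comp.
- by exists (rlam p), b; split=> //; [exists p|exact/bangP].
- by constructor.
Qed.

Lemma bang_pullback N N' :
  (forall t', Taylor N' t' -> exists2 t, Taylor N t & rge t t') ->
  forall b', bang (Taylor N') b' ->
  exists2 b, bang (Taylor N) b & forall s, rge (rapp s b) (rapp s b').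
Proof.
move=> NN' b'; rewrite -(seq_mset_id b') => /bangP.
(* The extra bag [c] stands for the elements not being reduced, so that the bag can be treated one
   element at a time. *)
suff: (forall t, t \in (b' : seq _) -> Taylor N' t) -> exists2 b, bang (Taylor N) b &
    forall s c, rge (rapp s (b `+` c)%mset) (rapp s (seq_mset b' `+` c)%mset).
  move=> + b'N => /(_ b'N)[b bN bge]; exists b => // s.
  by have := bge s mset0; rewrite !msetD0.
elim: (b' : seq _) => [|t' l IH] lN.
  exists (seq_mset [::]) => [t|s c]; first by rewrite mem_seq_mset.
  exact: rge_refl.
have [t Nt tt'] := NN' t' (lN _ (mem_head _ _)).
have [u ul|b bN bge] := IH; first by apply: lN; rewrite inE ul orbT.
exists (t +` b)%mset => [u|s c].
  by rewrite in_mset1D => /predU1P[->|/bN].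
rewrite mset_cons -!msetDA; apply: rge_trans (rge_bag _ _ tt') _.
by rewrite !(msetDCA [mset t']%mset).
Qed.

(** A step in an argument must be repeated in each element of the bag, which takes several resource
    steps, or none if the bag is empty; hence [rge]. *)
Lemma beta_pullback M M' t' : beta M M' -> Taylor M' t' ->
  exists2 t, Taylor M t & rge t t'.
Proof.
move=> bM; elim: bM t' => {M M'} /=.
- move=> M N t' /Taylor_redex[t [a [tMN ta t'a]]]; exists t => //.
  exact: rge_rstep ta t'a.
- move=> M M' _ IH _ [s' /IH[s Ms ss'] <-].
  by exists (rlam s); [exists s|exact: rge_rlam].
- move=> M M' N _ IH _ [s' [b [/IH[s Ms ss'] bN ->]]].
  by exists (rapp s b); [exists s, b|exact: rge_rapp].
- move=> M N N' _ IH _ [s [b' [Ms /(bang_pullback IH)[b bN bge] ->]]].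
  by exists (rapp s b); [exists s, b|].
- by move=> M M' N _ IH t' [/IH[t Mt tt']|Nt'];
    [exists t => //; left|exists t'; [right|exact: rge_refl]].
- by move=> M N N' _ IH t' [Mt'|/IH[t Nt tt']];
    [exists t'; [left|exact: rge_refl]|exists t => //; right].
Qed.

Lemma beta_mod_pullback M M' t' : beta_mod M M' -> Taylor M' t' ->
  exists2 t, Taylor M t & rge t t'.
Proof.
move=> [P [P' [/Taylor_teq-> bP /Taylor_teq<-]]]; exact: beta_pullback.
Qed.

Lemma sstep_beta_mod b s M : sstep b s M -> beta_mod s M.
Proof.
have cong (C : term -> term) : (forall P Q, teq P Q -> teq (C P) (C Q)) ->
    (forall P Q, beta P Q -> beta (C P) (C Q)) ->
    forall P Q, beta_mod P Q -> beta_mod (C P) (C Q).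
  by move=> Ct Cb P Q [P' [Q' [? ? ?]]]; exists (C P'), (C Q'); split; auto.
elim=> {b s M} [s N|_ s M _|_ s M N _|s N N'].
- by exists (App (Lam s) N), (subst 0 N s); split; [exact: teq_refl|constructor|exact: teq_refl].
- by apply: cong => *; constructor.
- apply: (cong (App^~ N)) => *; constructor=> //; exact: teq_refl.
- apply: (cong (App s)) => *; constructor=> //; exact: teq_refl.
Qed.

(** Outside of arguments no bag is crossed, so the redex occurs exactly once in the approximant and
    a genuine step is obtained. *)
Lemma sstep_rstep s M t' : sstep true s M -> Taylor M t' ->
  exists t a, [/\ Taylor s t, rstep t a & t' \in a].
Proof.
move E: true => b sM; elim: sM E t' => {b s M} [s N _ t'|b s M _ IH eb t'|b s M N _ IH eb t'|//].
- exact: Taylor_redex.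
- move=> [u /(IH eb)[t [a [st ta ua]]] <-].
  exists (rlam t), (lin_ext rlam a); split; [by exists t|by constructor|].
  by rewrite mem_seq_mset map_f.
- move=> [u [c [/(IH eb)[t [a [st ta ua]]] cN ->]]].
  exists (rapp t c), (lin_ext (rapp^~ c) a); split; [by exists t, c|by constructor|].
  by rewrite mem_seq_mset; apply: map_f.
Qed.


(** * Linear elements of Taylor supports *)

Lemma linear_rvar n : linear (rvar n).
Proof. by move=> b; move E: (rvar n) => t bt; case: bt E. Qed.

Lemma linear_rlam s : linear s -> linear (rlam s).
Proof.
move=> sl b; move E: (rlam s) => t bt.
by case: bt E => [u|u bu /rlam_inj eq_u|u c _|u v c _ _] //; apply: sl; rewrite eq_u.
Qed.

(** The singleton bag is written as an addition to [mset0] to match the shape of [rge_bag]. *)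
Lemma linear_rapp s t : linear s -> linear t -> linear (rapp s (t +` mset0)%mset).
Proof.
move=> sl tl b; move E: (rapp _ _) => u bu; case: bu E => [v|v _|v c bv|v w c wc bw] //.
- move=> /rapp_inj[_ <-]; rewrite msetD0.
  by rewrite enum_msetn.
- by move=> /rapp_inj[eq_v _]; apply: sl; rewrite eq_v.
- move=> /rapp_inj[_ eq_c]; apply: tl.
  by move: wc; rewrite -eq_c msetD0 in_mset1 => /eqP <-.
Qed.

(** Take singleton bags throughout and the left summand of each sum. *)
Lemma Taylor_linear M : exists2 t, Taylor M t & linear t.
Proof.
elim: M => [n|M [s Ms sl]|M [s Ms sl] N [t Nt tl]|M [s Ms sl] N _].
- by exists (rvar n) => //; exact: linear_rvar.
- by exists (rlam s); [exists s|exact: linear_rlam].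
- exists (rapp s (t +` mset0)%mset); last exact: linear_rapp.
  exists s, (t +` mset0)%mset; split=> // u.
  by rewrite msetD0 in_mset1 => /eqP->.
- by exists s => //; left.
Qed.

(** * Bounds and strong normalizability *)

(** The largest set of [up_struct linear_struct]. *)
Definition linearizable (t : rterm) : Prop := up [set s | linear s] t.

Lemma linearizable_rge t s : rge t s -> linearizable s -> linearizable t.
Proof. by move=> ts [u [ul su]]; exists u; split=> //; exact: rge_trans su. Qed.

Lemma linearizable_linear t : linear t -> linearizable t.
Proof. by move=> tl; exists t; split=> //; exact: rge_refl. Qed.

Lemma linearizable_rlam t : linearizable t -> linearizable (rlam t).
Proof.
by move=> [u [ul tu]]; exists (rlam u); split; [exact: linear_rlam|exact: rge_rlam].
Qed.

Lemma linearizable_rapp s t : linearizable s -> linearizable t ->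
  linearizable (rapp s (t +` mset0)%mset).
Proof.
move=> [v [vl sv]] [w [wl tw]]; exists (rapp v (w +` mset0)%mset).
split; first exact: linear_rapp.
exact: rge_trans (rge_rapp _ sv) (rge_bag _ _ tw).
Qed.

(** The restriction to linearizable elements matters: bags of arbitrary size make the sizes in
    [Taylor M] unbounded as soon as [M] contains an application. *)
Definition bounded_by (n : nat) (M : term) : Prop :=
  forall t, Taylor M t -> linearizable t -> rsize t < n.

Lemma bounded_by_beta_mod n M M' : beta_mod M M' -> bounded_by n M -> bounded_by n M'.
Proof.
move=> bM nM t' M't' t'l; have [t Mt tt'] := beta_mod_pullback bM M't'.
exact: leq_ltn_trans (rge_rsize tt') (nM t Mt (linearizable_rge tt' t'l)).
Qed.

Lemma bounded_by_sstep n s M : sstep true s M -> bounded_by n.+1 s -> bounded_by n M.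
Proof.
move=> sM ns t' Mt' t'l; have [t [a [st ta t'a]]] := sstep_rstep sM Mt'.
apply: leq_trans (rstep_rsize ta t'a) _.
exact: ns t st (linearizable_rge (rge_rstep ta t'a) t'l).
Qed.

Lemma bounded_by_Lam n M : bounded_by n.+1 (Lam M) -> bounded_by n M.
Proof.
move=> nM t Mt tl; rewrite -ltnS -rsize_rlam.
by apply: nM; [exists t|exact: linearizable_rlam].
Qed.

(** A linearizable element for one side, completed by a linear one for the other side, gives a
    strictly larger linearizable element for the application. *)
Lemma bounded_by_App n M N :
  bounded_by n.+1 (App M N) -> bounded_by n M /\ bounded_by n N.
Proof.
have [s0 Ms0 /linearizable_linear s0l] := Taylor_linear M.
have [t0 Nt0 /linearizable_linear t0l] := Taylor_linear N.
have appT s t : Taylor M s -> Taylor N t -> Taylor (App M N) (rapp s (t +` mset0)%mset).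
  move=> Ms Nt; exists s, (t +` mset0)%mset; split=> // u.
  by rewrite msetD0 in_mset1 => /eqP->.
move=> nMN; split=> [s Ms sl|t Nt tl].
  have := nMN _ (appT s t0 Ms Nt0) (linearizable_rapp sl t0l).
  by rewrite rsize_rapp1D; lia.
have := nMN _ (appT s0 t Ms0 Nt) (linearizable_rapp s0l tl).
by rewrite rsize_rapp1D; lia.
Qed.

Lemma bounded_by_leq m n M : m <= n -> bounded_by m M -> bounded_by n M.
Proof. by move=> mn mM t Mt tl; exact: leq_trans (mM t Mt tl) mn. Qed.

Lemma Taylor_summands M :
  List.Forall (fun s => simple s /\ Taylor s `<=` Taylor M) (summands M).
Proof.
elim: M => [n|M IH|M IH N _|M IHM N IHN] /=.
- by constructor; [split|constructor].
- apply/List.Forall_map; apply: List.Forall_impl IH => s [ss sM]; split=> //=.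
  exact: image_subset.
- apply/List.Forall_map; apply: List.Forall_impl IH => s [ss sM]; split=> //=.
  by move=> _ [t [b [st bN ->]]]; exists t, b; split=> //; exact: sM.
- apply/List.Forall_app; split.
    by apply: List.Forall_impl IHM => s [ss sM]; split=> // t /sM; left.
  by apply: List.Forall_impl IHN => s [ss sN]; split=> // t /sN; right.
Qed.

Lemma lSN_summands n M :
  (forall s, simple s -> bounded_by n s -> lSN [:: s]) ->
  bounded_by n M -> lSN (summands M).
Proof.
move=> sSN nM; elim: (Taylor_summands M) => [|s l [ss sM] _ IH].
  by constructor=> L st; inversion st.
have sn : bounded_by n s by move=> t /sM; exact: nM.
exact: (@lSN_cat [:: s] l (sSN s ss sn) IH).
Qed.

Lemma bounded_by_lSN n M : bounded_by n M -> lSN (summands M).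
Proof.
elim: n M => [|n IH] M nM.
  (* The bound 0 is impossible, as some linear element always exists. *)
  by have [t Mt /linearizable_linear tl] := Taylor_linear M; have := nM t Mt tl.
have sSN s : simple s -> bounded_by n.+1 s -> lSN [:: s].
  move=> ss ns; have sacc : args_SN s.
    (* Along the spine the bound is weakened back to [n.+1]; the arguments keep the bound [n], to
       which the outer induction applies. *)
    elim: s ss ns => [//|s IHs ss /bounded_by_Lam ns|s IHs N _ ss /bounded_by_App[ns nN]|//].
      exact: IHs ss (bounded_by_leq (leqnSn n) ns).
    split; first exact: IHs ss (bounded_by_leq (leqnSn n) ns).
    exact/lSN_SN/IH.
  (* For a fixed bound, induction on the steps inside arguments. *)
  elim: (args_SN_Acc sacc) ss ns => {s sacc}s _ IHs ss ns; constructor=> L st.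
  inversion st as [|b s' l L0 st0|b c s' M' l L0 sM' st0]; subst.
    by inversion st0.
  inversion st0; subst; rewrite cats0.
  (* A step outside of arguments lowers the bound to [n]; its reduct need not be simple, which is
     why [IH] concerns all terms. *)
  case: c sM' => sM'; first exact/IH/(bounded_by_sstep sM').
  have sM := sstep_simple sM' ss.
  rewrite (simple_summands sM); apply: IHs => //.
  exact: bounded_by_beta_mod (sstep_beta_mod sM') ns.
exact: lSN_summands sSN nM.
Qed.

Lemma finite_bounded_by M :
  finite_set (Taylor M `&` up [set s | linear s]) -> exists n, bounded_by n M.
Proof.
(* The sum of the sizes serves as a bound on each of them. *)
move=> /finite_seqP[l eq_l]; exists (sumn (map rsize l)).+1 => t Mt tl; rewrite ltnS.
have tl' : t \in l by have : [set` l] t by rewrite -eq_l.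
by rewrite sumnE big_map (big_rem t) //= leq_addr.
Qed.

Theorem theorem5 :
  (forall (T : structure) (M : term),
     linear_struct `<=` T ->
     orth (up_struct T) (Taylor M) -> strongly_normalizable M) /\
  (forall M : term,
     orth (up_struct linear_struct) (Taylor M) -> strongly_normalizable M) /\
  (forall M : term,
     orth (up_struct bounded_struct) (Taylor M) -> strongly_normalizable M).
Proof.
have main T M : linear_struct `<=` T ->
    orth (up_struct T) (Taylor M) -> strongly_normalizable M.
  (* A single test set suffices: the set of all linear terms, which lies in [T]. *)
  move=> LT MT; have upT : up_struct T (up [set s | linear s]).
    by exists [set s | linear s] => //; apply: LT.
  have [n nM] := finite_bounded_by (MT _ upT).
  exact/SN_strongly_normalizable/lSN_SN/(bounded_by_lSN nM).
split; first exact: main.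
split=> M; apply: main => // a aL; exists 1 => t b /aL tl bt.
by rewrite (tl b bt).
Qed.
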